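(* If $G$ is a $2$-edge-connected claw-free cubic graph, then $G$ is $(1,1,1,3)$-packing edge-colorable; that is, $E(G)$ can be partitioned into sets $E_1, E_2, E_3, E_4$ such that each of $E_1, E_2, E_3$ is a matching and any two distinct edges of $E_4$ are at edge-distance at least $4$.
   Context: Graphs are finite and simple. A graph is claw-free if it contains no induced subgraph isomorphic to $K_{1,3}$; it is cubic if every vertex has degree $3$; it is $2$-edge-connected if it is connected and has no bridge. The edge-distance between two edges of $G$ is their distance as vertices in the line graph of $G$. For a non-decreasing sequence of positive integers $S=(s_1,\dots,s_k)$, an $S$-packing edge-coloring of $G$ is a partition of $E(G)$ into sets $E_1,\dots,E_k$ such that for each $i$, any two distinct edges of $E_i$ have edge-distance at least $s_i+1$. *)

(* Defs.v *)
From HB Require Import structures.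
From mathcomp Require Import all_boot.
Set Implicit Arguments.
Unset Strict Implicit.
Unset Printing Implicit Defensive.

Record sgraph := SGraph {
  vertex :> finType;
  adj : rel vertex;
  adj_sym : symmetric adj;
  adj_irr : irreflexive adj
}.

Definition edges (G : sgraph) : {set {set G}} :=
  [set e | [exists x, exists y, adj x y && (e == [set x; y])]].

Definition neighbours (G : sgraph) (x : G) : {set G} := [set y | adj x y].

Definition cubic (G : sgraph) : Prop := forall x : G, #|neighbours x| = 3.

Definition isomorphic (G H : sgraph) : Prop :=
  exists f : G -> H, bijective f /\ forall x y, adj (f x) (f y) = adj x y.

Section Induced.
Variables (G : sgraph) (A : {set G}).
Definition induced_adj : rel {x : G | x \in A} :=
  fun x y => adj (val x) (val y).
Lemma induced_adj_sym : symmetric induced_adj.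
Proof. by move=> x y; rewrite /induced_adj adj_sym. Qed.
Lemma induced_adj_irr : irreflexive induced_adj.
Proof. by move=> x; rewrite /induced_adj adj_irr. Qed.
Definition induced : sgraph := SGraph induced_adj_sym induced_adj_irr.
End Induced.

Section CompleteBipartite.
Variables m n : nat.
Definition bip_adj : rel ('I_m + 'I_n)%type :=
  fun x y => match x, y with
    | inl _, inr _ | inr _, inl _ => true
    | _, _ => false
    end.
Lemma bip_adj_sym : symmetric bip_adj.
Proof. by case=> ? [] ?. Qed.
Lemma bip_adj_irr : irreflexive bip_adj.
Proof. by case. Qed.
Definition complete_bipartite : sgraph := SGraph bip_adj_sym bip_adj_irr.
End CompleteBipartite.

Definition claw_free (G : sgraph) : Prop :=
  forall A : {set G}, ~ isomorphic (induced A) (complete_bipartite 1 3).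

Definition connected_graph (G : sgraph) : Prop :=
  0 < #|G| /\ forall x y : G, connect (@adj G) x y.

Section DeleteEdge.
Variables (G : sgraph) (e : {set G}).
Definition del_adj : rel G := fun x y => adj x y && ([set x; y] != e).
Lemma del_adj_sym : symmetric del_adj.
Proof. by move=> x y; rewrite /del_adj adj_sym setUC. Qed.
Lemma del_adj_irr : irreflexive del_adj.
Proof. by move=> x; rewrite /del_adj adj_irr. Qed.
Definition delete_edge : sgraph := SGraph del_adj_sym del_adj_irr.
End DeleteEdge.

Definition num_components (G : sgraph) : nat := n_comp (@adj G) predT.

Definition bridge (G : sgraph) (e : {set G}) : Prop :=
  e \in edges G /\ num_components G < num_components (delete_edge e).

Definition two_edge_connected (G : sgraph) : Prop :=
  connected_graph G /\ forall e : {set G}, ~ bridge e.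

Section LineGraph.
Variable G : sgraph.
Definition line_adj : rel {e : {set G} | e \in edges G} :=
  fun e f => (e != f) && (val e :&: val f != set0).
Lemma line_adj_sym : symmetric line_adj.
Proof. by move=> e f; rewrite /line_adj eq_sym setIC. Qed.
Lemma line_adj_irr : irreflexive line_adj.
Proof. by move=> e; rewrite /line_adj eqxx. Qed.
Definition line_graph : sgraph := SGraph line_adj_sym line_adj_irr.
End LineGraph.

Definition walk_of_length (G : sgraph) (x y : G) (n : nat) : Prop :=
  exists p : seq G, [/\ path (@adj G) x p, last x p = y & size p = n].

(* No [n] satisfies this when [x] and [y] lie in different components, that is,
   when their distance is infinite. *)
Definition distance_is (G : sgraph) (x y : G) (n : nat) : Prop :=
  walk_of_length x y n /\ forall m, walk_of_length x y m -> n <= m.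

Definition distance_at_least (G : sgraph) (x y : G) (d : nat) : Prop :=
  forall n, distance_is x y n -> d <= n.

Definition edge_distance_at_least (G : sgraph) (e f : line_graph G) (d : nat) :
  Prop := distance_at_least e f d.

(* The classes [E i] are allowed to be empty. *)
Definition packing_edge_coloring (G : sgraph) (S : seq nat)
    (E : 'I_(size S) -> {set line_graph G}) : Prop :=
  (forall e : line_graph G, exists! i, e \in E i) /\
  (forall i (e f : line_graph G), e \in E i -> f \in E i -> e != f ->
     edge_distance_at_least e f (nth 0 S i).+1).

(* Used only for non-decreasing sequences [S] of positive integers. *)
Definition packing_edge_colorable (G : sgraph) (S : seq nat) : Prop :=
  exists E : 'I_(size S) -> {set line_graph G}, packing_edge_coloring E.

(* Main.v *)
Require Import Defs.
From mathcomp Require Import all_boot zify.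
Set Implicit Arguments.
Unset Strict Implicit.
Unset Printing Implicit Defensive.

(** In a claw-free cubic graph the components of the edges lying in triangles
    ("cells") are triangles, diamonds and K4's, and every vertex has at most one
    further edge, its link. Colour the links with three colours so that the two
    links of a diamond agree. Such a colouring extends to a proper 3-edge-colouring
    of every diamond, of every K4, and of every triangle whose three links have
    distinct colours; a conflicting triangle needs exactly one edge of the fourth
    colour, and if its links all have the same colour this edge can be any of the
    three.

    Choose the colouring of the links with the fewest conflicting triangles, then
    the fewest monochromatic ones, then the fewest linked pairs of conflicting
    triangles with different repeated colours. A Kempe chain starting at one of
    the two equally coloured links of a conflicting triangle must return to the
    other one, for otherwise a swap removes a conflict. Hence a conflicting
    triangle is linked to at most one other conflicting triangle, through the link
    with the exceptional colour, and swapping such a closed chain changes the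
    repeated colour of a single triangle, so both triangles have the same repeated
    colour. Recolouring the common link with it makes both triangles
    monochromatic, and the fourth colour is placed on the edges opposite to the
    common link, which are at edge-distance 4. *)

Lemma set3_third (T : finType) (A : {set T}) x y : #|A| = 3 -> x \in A -> y \in A ->
  x != y -> exists z, [/\ z \in A, z != x, z != y &
    forall w, w \in A -> [|| w == x, w == y | w == z]].
Proof.
move=> A3 xA yA xy.
have : #|A :\ x :\ y| = 1.
  have := cardsD1 x A; have := cardsD1 y (A :\ x).
  by rewrite !inE xA yA eq_sym xy A3 /=; lia.
move/eqP/cards1P=> [z Ez].
have : z \in A :\ x :\ y by rewrite Ez inE.
rewrite !inE => /and3P[zy zx zA]; exists z; split=> // w wA.
case: (eqVneq w x) => //= wx; case: (eqVneq w y) => //= wy.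
have : w \in A :\ x :\ y by rewrite !inE wx wy.
by rewrite Ez inE.
Qed.

(** * Kempe chains on the links *)

Section Orbit.
Variables (X : finType) (o b : X -> X).
Hypotheses (oK : involutive o) (bK : involutive b).
Let f x := b (o x).

Let f_inj : injective f.
Proof. by move=> x y /(inv_inj bK) /(inv_inj oK). Qed.

Definition chain (p : X) : {set X} := [set x | fconnect f p x].

Lemma chain_start p : p \in chain p.
Proof. by rewrite inE connect0. Qed.

(** As [b] fixes [p], it reverses the orbit: it sends the point [k] steps after [p] to the one [k]
    steps before. *)
Let fb k p : b p = p -> iter k f (b (iter k f p)) = p.
Proof.
move=> bp; elim: k => [|k IH] //=.
by rewrite -iterS iterSr {2}/f bK {1}/f /= oK.
Qed.

Lemma chain_stable p : b p = p ->
  (forall x, x \in chain p -> o x \in chain p) /\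
  (forall x, x \in chain p -> b x \in chain p).
Proof.
move=> bp; have Hb x : x \in chain p -> b x \in chain p.
  rewrite !inE => /iter_findex <-; set k := findex _ _ _.
  by rewrite fconnect_sym // -{2}(fb k bp) fconnect_iter.
split=> // x Hx; rewrite -[o x]bK; apply: Hb; rewrite !inE in Hx *.
by apply: connect_trans Hx _; apply: fconnect1.
Qed.

(* The involution [b] reverses the [b \o o]-cycle through [p], so it fixes at
   most one point of that cycle besides [p]. *)
Lemma chain_ends p q w : b p = p -> b q = q -> b w = w ->
  q \in chain p -> w \in chain p -> q != p -> w != p -> w = q.
Proof.
move=> bp.
have key x : b x = x -> x \in chain p -> x != p ->
    x = iter (order f p)./2 f p.
  move=> bx; rewrite inE => Hx xp.
  have lt := findex_max Hx; set k := findex f p x in lt *.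
  have kx : iter k f p = x by apply: iter_findex.
  (* By [fb], another [k] steps lead from [x] back to [p]. With [k] positive and below the order,
     [k.*2] must be the order, so [x] lies opposite to [p] on the cycle. *)
  have E : iter k.*2 f p = p.
    by have := fb k bp; rewrite -addnn iterD kx bx.
  have k0 : k != 0 by apply: contraNneq xp => k0; rewrite -kx k0.
  have : k.*2 = order f p.
    case: (ltngtP k.*2 (order f p)) => // H.
      by have := findex_iter H; rewrite E findex0; lia.
    have H2 : k.*2 - order f p < order f p by lia.
    have := findex_iter H2.
    have -> : iter (k.*2 - order f p) f p = p.
      by have := E; rewrite -{1}(subnK (ltnW H)) iterD iter_order.
    rewrite findex0; lia.
  by move=> <-; rewrite doubleK kx.
by move=> bq bw Hq Hw qp wp; rewrite (key q) // (key w).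
Qed.
End Orbit.

Lemma ord3_third (i k : 'I_3) : i != k -> exists2 j, j != i & j != k.
Proof.
move=> ik; have : 0 < #|~: [set i; k]|.
  by rewrite -(leq_add2l #|[set i; k]|) cardsC card_ord cards2 ik.
by case/card_gt0P => j; rewrite !inE negb_or => /andP[? ?]; exists j.
Qed.

Section Kempe.
(* [X] is the set of ports, [o] follows the link leaving a port, and [e] relates
   the ports of a common cell. *)
Variables (X : finType) (o : X -> X) (e : rel X).
Hypotheses (oK : involutive o) (exx : reflexive e) (eC : symmetric e).
Hypothesis eT : transitive e.
Hypothesis e_le3 : forall x, #|[set y | e x y]| <= 3.

Definition tri x := #|[set y | e x y]| == 3.

Hypothesis oN : forall x, tri x -> ~~ e x (o x).

Let e_eq x y : e x y -> e x =1 e y.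
Proof.
move=> xy z; apply/idP/idP; last exact: eT.
by apply: eT; rewrite eC.
Qed.

Let tri_eq x y : e x y -> tri x = tri y.
Proof.
by move=> /e_eq E; rewrite /tri; congr (#|pred_of_set _| == _); apply/setP=> z; rewrite !inE E.
Qed.

Lemma triP x y : tri x -> e x y -> y != x ->
  exists z, [/\ e x z, z != x, z != y & forall w, e x w -> [|| w == x, w == y | w == z]].
Proof.
move=> /eqP tx xy yx.
have [|||z [xz zx zy all]] := set3_third (x := x) (y := y) tx; rewrite ?inE //.
  by rewrite eq_sym.
exists z; split=> //; first by rewrite inE in xz.
by move=> w xw; apply: all; rewrite inE.
Qed.

Lemma tri_ex x : tri x -> exists2 y, e x y & x != y.
Proof.
move=> /eqP tx; have : 0 < #|[set y | e x y] :\ x|.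
  by move: tx; rewrite (cardsD1 x) inE exx add1n => -[->].
by case/card_gt0P => y; rewrite !inE eq_sym => /andP[? ?]; exists y.
Qed.

Lemma ntri_uniq x y z : ~~ tri x -> e x y -> e x z -> y != x -> z != x -> y = z.
Proof.
move=> tx xy xz yx zx; apply/eqP; apply: contraR tx => yz.
rewrite /tri eqn_leq e_le3 /=.
have sub : [set x; y; z] \subset [set z0 | e x z0].
  by apply/subsetP=> t; rewrite !inE => /orP[/orP[]|] /eqP->.
apply: leq_trans (subset_leq_card sub).
by rewrite -setUA cardsU1 cards2 !inE negb_or yz eq_sym yx eq_sym zx.
Qed.

Implicit Type c : {ffun X -> 'I_3}.

(** A colour is that of a link, read off at both ends. Blocks with fewer than three ports, such as
    the two tips of a diamond, must be monochromatic for the cell to be filled in. *)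
Definition valid c :=
  [forall x, (c (o x) == c x) && (tri x || [forall y, e x y ==> (c y == c x)])].

Lemma validP c : reflect ((forall x, c (o x) = c x) /\
    forall x y, ~~ tri x -> e x y -> c y = c x) (valid c).
Proof.
apply: (iffP forallP) => [H|[H1 H2] x].
  split=> [x|x y tx xy]; have /andP[/eqP //] := H x.
  by rewrite (negPf tx) /= => _ /forallP/(_ y); rewrite xy => /eqP.
rewrite H1 eqxx /=; case: (boolP (tri x)) => //= tx.
by apply/forallP=> y; apply/implyP=> xy; rewrite (H2 x).
Qed.

Definition conf c x :=
  tri x && [exists y, exists z, [&& e x y, e x z, y != z & c y == c z]].

Lemma confPn c x : tri x ->
  reflect (forall y z, e x y -> e x z -> y != z -> c y != c z) (~~ conf c x).
Proof.
rewrite /conf => -> /=; apply: (iffP idP) => [H y z xy xz yz|H].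
  apply: contra H => yz'.
  by apply/existsP; exists y; apply/existsP; exists z; rewrite xy xz yz.
apply/existsP=> -[y /existsP[z /and4P[xy xz yz]]].
by apply/negP; apply: H.
Qed.

Lemma conf_intro c x y z : tri x -> e x y -> e x z -> y != z -> c y = c z -> conf c x.
Proof.
by move=> tx xy xz yz E; apply/contraT => /(confPn _ tx)/(_ y z xy xz yz); rewrite E eqxx.
Qed.

Lemma conf_tri c x : conf c x -> tri x. Proof. by case/andP. Qed.

Lemma conf_eq c x y : e x y -> conf c x = conf c y.
Proof.
move=> xy; rewrite /conf (tri_eq xy); congr (_ && _).
by apply: eq_existsb => u; apply: eq_existsb => v; rewrite !(e_eq xy).
Qed.

Definition mono c x := tri x && [forall y, e x y ==> (c y == c x)].

Lemma monoP c x : mono c x -> forall y, e x y -> c y = c x.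
Proof. by case/andP=> _ /forallP H y xy; have := H y; rewrite xy => /eqP. Qed.

Lemma mono_conf c x : mono c x -> conf c x.
Proof.
move=> mx; have /andP[tx _] := mx; have [y xy nxy] := tri_ex tx.
by apply: (conf_intro tx (exx x) xy nxy); rewrite (monoP mx xy).
Qed.

(** By [not_mono] and [link_port] below, the ports of linked conflicting blocks off the common link
    carry the repeated colours, so for a [mu]-minimal colouring this compares those colours. *)
Definition bad c x := [&& conf c x, conf c (o x) &
  [exists y, exists z, [&& e x y, y != x, e (o x) z, z != o x & c y != c z]]].

Lemma badP c x : reflect (exists y z, [/\ conf c x, conf c (o x) &
    [/\ e x y, y != x, e (o x) z, z != o x & c y != c z]]) (bad c x).
Proof.
apply: (iffP and3P) => [[cx cox /existsP[y /existsP[z /and5P H]]]|[y [z [cx cox H]]]].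
  by exists y, z.
by split=> //; apply/existsP; exists y; apply/existsP; exists z; apply/and5P.
Qed.

(** * Swapping two colours along Kempe chains *)

Section Swap.
Variables (c : {ffun X -> 'I_3}) (i j : 'I_3).

Definition inn (k : 'I_3) := (k == i) || (k == j).
Definition sw (k : 'I_3) := if k == i then j else if k == j then i else k.

Lemma inn_sw k : inn (sw k) = inn k.
Proof.
rewrite /inn /sw; case: (eqVneq k i) => [_|ki]; first by rewrite eqxx orbT.
case: (eqVneq k j) => [_|kj]; first by rewrite eqxx.
by rewrite (negPf ki) (negPf kj).
Qed.

Lemma sw_id k : ~~ inn k -> sw k = k.
Proof. by rewrite /inn /sw; case: eqP => // _; case: eqP. Qed.

Lemma sw_inj : injective sw.
Proof.
have swK : involutive sw; last exact: inv_inj.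
move=> k; rewrite /sw; case: (eqVneq k i) => [->|ki].
  by case: (eqVneq j i) => [->|]; rewrite ?eqxx.
by case: (eqVneq k j) => [->|kj]; rewrite ?eqxx // (negPf ki) (negPf kj).
Qed.

(* One step of an [i]/[j]-Kempe chain inside a block; chains stop (fixed point)
   at conflicting blocks. *)
Definition kb x :=
  if ~~ conf c x && inn (c x) then
    odflt x [pick y | [&& e x y, y != x & inn (c y)]] else x.

Lemma kb_conf x : conf c x -> kb x = x.
Proof. by rewrite /kb => ->. Qed.

(** A block with fewer than three ports has only one other port, and the three distinct colours of a
    rainbow block cannot all lie among [i] and [j]. *)
Let kb_uniq x y z : ~~ conf c x -> inn (c x) -> e x y -> y != x -> inn (c y) ->
  e x z -> z != x -> inn (c z) -> y = z.
Proof.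
move=> nx ix xy yx iy xz zx iz; case: (boolP (tri x)) => tx; last exact: (ntri_uniq tx).
have P := elimT (confPn c tx) nx.
apply/eqP; apply: contraTT isT => yz.
have := P _ _ xy (exx x) yx; have := P _ _ xz (exx x) zx; have := P _ _ xy xz yz.
move: ix iy iz; rewrite /inn => /orP[] /eqP-> /orP[] /eqP-> /orP[] /eqP->;
  by rewrite ?eqxx.
Qed.

Lemma kb_eq x y : ~~ conf c x -> inn (c x) -> e x y -> y != x -> inn (c y) -> kb x = y.
Proof.
move=> nx ix xy yx iy; rewrite /kb nx ix /=; case: pickP => [z /and3P[xz zx iz]|/(_ y)].
  exact: (kb_uniq nx ix).
by rewrite xy yx iy.
Qed.

Lemma kbK : involutive kb.
Proof.
move=> x; rewrite {2}/kb; case: ifP => [/andP[nx ix]|H]; last by rewrite /kb H.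
case: pickP => [y /and3P[xy yx iy]|H] /=.
  by apply: kb_eq; rewrite -?(conf_eq c xy) // 1?eC // eq_sym.
rewrite /kb nx ix /=; case: pickP => // y; by rewrite H.
Qed.

Variable S : {set X}.

Definition swap : {ffun X -> 'I_3} := [ffun x => if x \in S then sw (c x) else c x].

Lemma swap_in x : x \in S -> swap x = sw (c x).
Proof. by rewrite ffunE => ->. Qed.
Lemma swap_out x : x \notin S -> swap x = c x.
Proof. by rewrite ffunE => /negPf->. Qed.
Lemma inn_swap x : inn (swap x) = inn (c x).
Proof. by rewrite ffunE; case: ifP; rewrite ?inn_sw. Qed.
Lemma swap_notinn x : ~~ inn (c x) -> swap x = c x.
Proof. by move=> H; rewrite ffunE; case: ifP; rewrite ?sw_id. Qed.

Definition stable := (forall x, x \in S -> o x \in S) /\ (forall x, x \in S -> kb x \in S).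
Hypothesis St : stable.

Let inS_kb x y : kb x = y -> (x \in S) = (y \in S).
Proof.
move=> E; apply/idP/idP=> [|H]; first by move/(proj2 St); rewrite E.
by rewrite -[x]kbK E; apply: (proj2 St).
Qed.

(** A small block is never conflicting, so [kb] exchanges its two ports when their colour is [i] or
    [j], and [S] contains both or neither. *)
Lemma swap_valid : valid c -> valid swap.
Proof.
move=> cV; have [V1 V2] := validP _ cV; apply/validP; split=> [x|x y tx xy].
  have E : (o x \in S) = (x \in S).
    by apply/idP/idP=> /(proj1 St) //; rewrite oK.
  by rewrite !ffunE E V1.
have E := V2 _ _ tx xy.
case: (eqVneq y x) => [->//|yx].
case: (boolP (inn (c x))) => ix; last by rewrite !swap_notinn // E.
rewrite !ffunE (@inS_kb x y) ?E //; apply: kb_eq; rewrite ?E //.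
by rewrite /conf (negPf tx).
Qed.

(** In a rainbow block the ports coloured [i] and [j] are exchanged by [kb], so both are swapped or
    neither is, and the block stays rainbow. *)
Lemma swap_conf x : conf swap x -> conf c x.
Proof.
move=> cx; have tx := conf_tri cx; apply: contraLR cx => nx.
have P := elimT (confPn c tx) nx.
apply/(confPn _ tx) => y z xy xz yz.
have cyz := P _ _ xy xz yz.
case: (boolP (inn (c y))) => iy; last first.
  case: (boolP (inn (c z))) => iz; last by rewrite !swap_notinn.
  by apply: contraNneq iy => E; rewrite -inn_swap E inn_swap.
case: (boolP (inn (c z))) => iz; last first.
  by apply: contraNneq iz => E; rewrite -inn_swap -E inn_swap.
have /inS_kb E : kb y = z.
  by apply: kb_eq; rewrite -?(conf_eq c xy) -?(e_eq xy) // eq_sym.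
by rewrite !ffunE E; case: ifP => //; rewrite (inj_eq sw_inj).
Qed.
End Swap.

(* Encodes the lexicographic order on the numbers of ports [x] with [conf c x],
   [mono c x] and [bad c x], each of which is at most [#|X|]. *)
Definition mu c := (#|[set x | conf c x]| * #|X|.+1 + #|[set x | mono c x]|) * #|X|.+1
  + #|[set x | bad c x]|.

Lemma exists_mu_minimal :
  exists2 c, valid c & forall c', valid c' -> mu c <= mu c'.
Proof.
have H : valid [ffun => ord0] by apply/validP; split=> *; rewrite !ffunE.
by case: (arg_minnP mu H) => c cV cM; exists c.
Qed.

(** * Properties of a colouring minimising [mu] *)

Variables (c : {ffun X -> 'I_3}) (cV : valid c).
Hypothesis cM : forall c', valid c' -> mu c <= mu c'.

Let bound (P : pred X) : #|[set x | P x]| < #|X|.+1.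
Proof. by rewrite ltnS max_card. Qed.

(** This and the next two facts unfold the lexicographic order: a valid colouring that adds nothing
    on any level up to a given one removes nothing on that level. *)
Let min_conf c' : valid c' -> (forall x, conf c' x -> conf c x) ->
  forall x, conf c x -> conf c' x.
Proof.
move=> V' sub x cx; apply/contraT => ncx; move: (cM V'); rewrite leqNgt => /negP[].
have lt : #|[set x | conf c' x]| < #|[set x | conf c x]|.
  apply: proper_card; apply/properP; split.
    by apply/subsetP=> y; rewrite !inE => /sub.
  by exists x; rewrite inE.
rewrite /mu; have := bound (mono c'); have := bound (bad c'); move: lt.
set a := #|_|; set b := #|_|; set m := #|X|.+1; move: a b m => a b m.
set u := #|_|; set v := #|_|; set w := #|_|; set s := #|_|; nia.
Qed.

Let min_mono c' : valid c' -> (forall x, conf c' x -> conf c x) ->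
  (forall x, mono c' x -> mono c x) -> forall x, mono c x -> mono c' x.
Proof.
move=> V' sub1 sub x cx; apply/contraT => ncx; move: (cM V'); rewrite leqNgt => /negP[].
have lt : #|[set x | mono c' x]| < #|[set x | mono c x]|.
  apply: proper_card; apply/properP; split.
    by apply/subsetP=> y; rewrite !inE => /sub.
  by exists x; rewrite inE.
have le : #|[set x | conf c' x]| <= #|[set x | conf c x]|.
  by apply: subset_leq_card; apply/subsetP=> y; rewrite !inE => /sub1.
rewrite /mu; have := bound (bad c'); move: lt le.
set a := #|_|; set b := #|_|; set u := #|_|; set v := #|_|.
set w := #|_|; set m := #|_|.+1; set s := #|_|; nia.
Qed.

Let min_bad c' : valid c' -> (forall x, conf c' x -> conf c x) ->
  (forall x, mono c' x -> mono c x) -> (forall x, bad c' x -> bad c x) ->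
  forall x, bad c x -> bad c' x.
Proof.
move=> V' sub1 sub2 sub x cx; apply/contraT => ncx; move: (cM V'); rewrite leqNgt => /negP[].
have lt : #|[set x | bad c' x]| < #|[set x | bad c x]|.
  apply: proper_card; apply/properP; split.
    by apply/subsetP=> y; rewrite !inE => /sub.
  by exists x; rewrite inE.
have le : #|[set x | conf c' x]| <= #|[set x | conf c x]|.
  by apply: subset_leq_card; apply/subsetP=> y; rewrite !inE => /sub1.
have le2 : #|[set x | mono c' x]| <= #|[set x | mono c x]|.
  by apply: subset_leq_card; apply/subsetP=> y; rewrite !inE => /sub2.
rewrite /mu -addnS; apply: leq_add => //.
by rewrite leq_mul2r; apply/orP; right; apply: leq_add => //; rewrite leq_mul2r le orbT.
Qed.


(** Chains stop at conflicting blocks, so a link between two of them is a whole chain for any two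
    colours. *)
Let stable_link i j x : conf c x -> conf c (o x) -> stable c i j [set x; o x].
Proof.
move=> cx cox; split=> y; rewrite !inE => /orP[] /eqP->; rewrite ?oK ?eqxx ?orbT //.
  by rewrite kb_conf // eqxx.
by rewrite kb_conf // eqxx orbT.
Qed.

(* Otherwise swapping [i] and [j] along [S] would make the block of [x] rainbow
   without creating any new conflict. *)
Let conf_pair i j k x y z (S : {set X}) : conf c x -> y != x -> z != x -> z != y ->
  e x y -> e x z -> c x = i -> c y = i -> c z = k -> i != k -> j != i -> j != k ->
  stable c i j S -> x \in S -> y \in S.
Proof.
move=> cx yx zx zy xy xz ci cyi ck ik ji jk St xS; apply/contraT=> yS.
have tx := conf_tri cx.
have := min_conf (swap_valid St cV) (swap_conf St) cx.
apply: contraTT => _; apply/(confPn _ tx).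
have nz : ~~ inn i j (c z) by rewrite ck /inn negb_or eq_sym ik eq_sym jk.
have xj : swap c i j S x = j by rewrite swap_in // /sw ci eqxx.
have yi : swap c i j S y = i by rewrite swap_out // cyi.
have zk : swap c i j S z = k by rewrite swap_notinn.
have [z' [xz' z'x z'y all]] := triP (conf_tri cx) xy yx.
have E : z' = z.
  by have := all _ xz; rewrite (negPf zx) (negPf zy) => /eqP.
move: all; rewrite E => all u v /all + /all.
case/or3P => /eqP->; case/or3P => /eqP->; rewrite ?eqxx // ?xj ?yi ?zk // => _;
  by rewrite eq_sym.
Qed.

(** If [y] repeated the colour of [x], then [conf_pair], applied to the chain made of the link of
    [x] alone, would put [y] on that link, although the link leaves the block. So the link has the
    exceptional colour. *)
Let link_port x y : conf c x -> conf c (o x) -> ~~ mono c x -> e x y -> y != x -> c y != c x.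
Proof.
move=> cx cox nm xy yx; have tx := conf_tri cx.
apply/negP=> /eqP E; have [z [xz zx zy all]] := triP (conf_tri cx) xy yx.
have ik : c x != c z.
  apply: contra nm => /eqP E2; rewrite /mono tx; apply/forallP=> w; apply/implyP.
  by move=> /all /or3P[] /eqP-> //; rewrite ?E -?E2.
have [j ji jk] := ord3_third ik.
have : y \in [set x; o x].
  apply: (conf_pair cx yx zx zy xy xz (erefl _) E (erefl _) ik ji jk).
    exact: stable_link.
  by rewrite !inE eqxx.
rewrite !inE (negPf yx) /= => /eqP yo.
by have := oN tx; rewrite -yo xy.
Qed.

(* Recolouring only the link of [x] keeps all conflicts but breaks [mono c x]. *)
Let not_mono x : conf c x -> conf c (o x) -> ~~ mono c x.
Proof.
move=> cx cox; apply/negP=> mx; have tx := conf_tri cx.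
have tox := conf_tri cox; have [y oxy oy] := tri_ex tox.
(* Avoiding the colour of [x] makes the block of [x] cease to be monochromatic; avoiding that of [y]
   keeps the block of [o x] from becoming so. *)
have [k' k'k k'y] : exists2 k', k' != c x & k' != c y.
  case: (eqVneq (c x) (c y)) => [<-|]; last exact: ord3_third.
  have [k H] : exists k, c x != k.
    have : 0 < #|~: [set c x]| by rewrite cardsC1 card_ord.
    by case/card_gt0P => k; rewrite !inE => H; exists k; rewrite eq_sym.
  by exists k; rewrite eq_sym.
have St := stable_link (c x) k' cx cox.
set S := [set x; o x] in St; set c' := swap c (c x) k' S.
have V' : valid c' := swap_valid St cV.
have sub := swap_conf St.
have [V1 _] := validP _ cV.
have nxo : ~~ e (o x) x by rewrite eC; apply: oN.
have c'x : c' x = k' by rewrite /c' swap_in /sw ?eqxx // !inE eqxx.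
have c'ox : c' (o x) = k' by rewrite -c'x; have [-> //] := validP _ V'.
have c'y : c' y = c y.
  rewrite /c' swap_out // !inE negb_or [y == o x]eq_sym oy andbT.
  by apply: contraNneq nxo => E; rewrite -{2}E.
have [z xz xz'] := tri_ex tx.
have c'z : c' z = c x.
  rewrite /c' swap_out ?(monoP mx) // !inE negb_or eq_sym xz' /=.
  by apply: contraNneq (oN tx) => <-.
have nm w : mono c' w -> ~~ e w x /\ ~~ e w (o x).
  move=> mw; split; apply/negP => ww.
    move: k'k; rewrite -c'x -c'z (monoP mw ww) (monoP mw) ?eqxx //.
    exact: eT ww xz.
  move: k'y; rewrite -c'ox -c'y (monoP mw ww) (monoP mw) ?eqxx //.
  exact: eT ww oxy.
have mm w : mono c' w -> mono c w.
  move=> mw; have [wx wox] := nm _ mw; have /andP[tw _] := mw.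
  have same u : e w u -> c' u = c u.
    move=> wu; rewrite /c' swap_out // !inE negb_or.
    by apply/andP; split; [apply: contraNneq wx => <-|apply: contraNneq wox => <-].
  rewrite /mono tw; apply/forallP=> u; apply/implyP=> wu.
  by rewrite -!same // (monoP mw).
have := min_mono V' sub mm mx => /nm[]; by rewrite exx.
Qed.

(* By [conf_pair] and [chain_ends], the Kempe chain starting at [z] meets the
   conflicting blocks exactly in the two equally coloured ports of the block of
   [o x], so swapping it makes the two blocks agree. *)
Let not_bad x : ~~ bad c x.
Proof.
apply/negP=> bx; have /badP[y [z [cx cox [xy yx oxz zox yz]]]] := bx.
have tx := conf_tri cx; have tox := conf_tri cox.
have mx := not_mono cx cox.
have mox : ~~ mono c (o x) by apply: not_mono; rewrite ?oK.
have P u : e x u -> u != x -> c u != c x by apply: link_port.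
have Q u : e (o x) u -> u != o x -> c u != c (o x) by apply: link_port; rewrite ?oK.
have [V1 V2] := validP _ cV.
have yeq u : e x u -> u != x -> c u = c y.
  move=> xu ux; apply/eqP; apply/contraT => uy.
  have [z' [xz' z'x z'y all]] := triP (conf_tri cx) xy yx.
  have E : u = z'.
    have := all _ xu; rewrite (negPf ux) /=; case/orP=> /eqP // E.
    by rewrite E eqxx in uy.
  have : ~~ conf c x; last by rewrite cx.
  apply/(confPn _ tx) => v w /all + /all.
  have A := P _ xy yx; have B := P _ xu ux.
  rewrite -E; case/or3P => /eqP->; case/or3P => /eqP->; rewrite ?eqxx // => _.
  - by rewrite eq_sym.
  - by rewrite eq_sym.
  - by rewrite eq_sym.
have [z2 [oz2 z2o z2z all]] := triP tox oxz zox.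
have cz2 : c z2 = c z.
  apply/eqP; apply/contraT => uy.
  have : ~~ conf c (o x); last by rewrite cox.
  apply/(confPn _ tox) => v w /all + /all.
  have A := Q _ oxz zox; have B := Q _ oz2 z2o.
  case/or3P => /eqP->; case/or3P => /eqP->; rewrite ?eqxx // => _.
  - by rewrite eq_sym.
  - by rewrite eq_sym.
  - by rewrite eq_sym.
have cz : conf c z by rewrite -(conf_eq c oxz).
have cz2c : conf c z2 by rewrite -(conf_eq c oz2).
set i := c y; set j := c z; set k := c x.
have ik : i != k by apply: P.
have jk : j != k by rewrite /k -V1; apply: Q.
have bK := kbK c j i.
have bz : kb c j i z = z by apply: kb_conf.
set S := chain o (kb c j i) z.
have St : stable c j i S := chain_stable oK bK bz.
have z2S : z2 \in S.
  have zo : e z (o x) by rewrite eC.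
  apply: (@conf_pair j i k z z2 (o x)) => //.
  - by rewrite eq_sym.
  - by rewrite eq_sym.
  - by rewrite -(e_eq oxz).
  - exact: chain_start.
have ends w : conf c w -> w \in S -> (w == z) || (w == z2).
  move=> cw wS; case: eqP => //= /eqP wz; apply/eqP.
  by apply: (chain_ends oK bK bz _ _ z2S wS) => //; rewrite kb_conf.
set c' := swap c j i S.
have V' : valid c' := swap_valid St cV.
have sub := swap_conf St.
have zS : z \in S := chain_start _ _ _.
have c'z : c' z = i by rewrite /c' swap_in // /sw eqxx.
have c'z2 : c' z2 = i by rewrite /c' swap_in // /sw cz2 eqxx.
have same w : conf c w -> w != z -> w != z2 -> c' w = c w.
  move=> cw wz wz2; rewrite /c' swap_out //.
  by apply/negP=> /(ends _ cw); rewrite (negPf wz) (negPf wz2).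
have c'ox : c' (o x) = k by rewrite same ?V1 // eq_sym.
(* Among ports of conflicting blocks only [z] and [z2] change colour, and their block is not
   monochromatic because [o x] keeps the colour [k]. *)
have mm w : mono c' w -> mono c w.
  move=> mw; have cw := sub _ (mono_conf mw); have tw := conf_tri cw.
  have [wz|wz] := boolP (e w z).
    have := monoP mw wz; rewrite c'z -(monoP mw (_ : e w (o x))); last first.
      by apply: eT wz _; rewrite eC.
    by rewrite c'ox => E; rewrite E eqxx in ik.
  have wz2 : ~~ e w z2.
    apply: contra wz => wz2; apply: eT wz2 _; apply: (@eT (o x)) => //; by rewrite eC.
  have H u : e w u -> c' u = c u.
    move=> wu; apply: same; first by rewrite -(conf_eq c wu).
      by apply: contraNneq wz => <-.
    by apply: contraNneq wz2 => <-.
  rewrite /mono tw; apply/forallP=> u; apply/implyP=> wu.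
  by rewrite -!H // (monoP mw).
(* If [u] were [z] or [z2], then [w] would be a port of their block. If [w] is [o x], both sides now
   show the colour [i]; otherwise the link at [w] has the repeated colour [j], against
   [link_port]. *)
have step w u v : conf c w -> conf c (o w) -> e w u -> u != w -> e (o w) v ->
    v != o w -> c' u != c' v -> (u != z) && (u != z2).
  move=> cw cow wu uw owv vow ne; rewrite -negb_or; apply/negP=> uz.
  have c'u : c' u = i by case/orP: uz => /eqP->.
  have cu : c u = j by case/orP: uz => /eqP->.
  have oxu : e (o x) u by case/orP: uz => /eqP->.
  have wo : e (o x) w by apply: eT oxu _; rewrite eC.
  case/or3P: (all _ wo) => /eqP E.
  - have vx : e x v by rewrite -[x]oK -E.
    have nvx : v != x by rewrite -[x]oK -E.
    have cv : conf c v by rewrite -(conf_eq c vx).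
    have H t : e (o x) t -> v != t.
      move=> ot; apply: contraNneq (oN tx) => vt; rewrite eC.
      by apply: eT ot _; rewrite eC -vt.
    by move: ne; rewrite c'u (same v) ?H // (yeq v) // eqxx.
  - have := link_port cw cow (not_mono cw cow) wu uw.
    by rewrite cu E eqxx.
  - have := link_port cw cow (not_mono cw cow) wu uw.
    by rewrite cu E cz2 eqxx.
have bb w : bad c' w -> bad c w.
  case/badP=> u [v [cw' cow' [wu uw owv vow uv]]].
  have cw := sub _ cw'; have cow := sub _ cow'.
  have /andP[u1 u2] := step _ _ _ cw cow wu uw owv vow uv.
  have /andP[v1 v2] : (v != z) && (v != z2).
    by apply: (@step (o w) v u); rewrite ?oK // eq_sym.
  have cu : conf c u by rewrite -(conf_eq c wu).
  have cv : conf c v by rewrite -(conf_eq c owv).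
  by apply/badP; exists u, v; rewrite -(same u) // -(same v).
have /badP[u [v [_ _ [xu ux oxv vox uv]]]] := min_bad V' sub mm bb bx.
have /andP[v1 v2] : (v != z) && (v != z2).
  by apply: (@step (o x) v u); rewrite ?oK // eq_sym.
by have := all _ oxv; rewrite (negPf vox) (negPf v1) (negPf v2).
Qed.

(** At a link between conflicting blocks this is the repeated colour; the default is not reached
    there, since such a block has three ports. *)
Let oc x := c (odflt x [pick y | e x y && (y != x)]).

(** As [x] is not [bad], every other port of its block has the colour of a fixed port across the
    link, so the choice made by [pick] is immaterial. *)
Let ocP x y : conf c x -> conf c (o x) -> e x y -> y != x -> oc x = c y.
Proof.
move=> cx cox xy yx; rewrite /oc; case: pickP => [u /andP[xu ux]|/(_ y)] /=; last first.
  by rewrite xy yx.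
have tx := conf_tri cox; have [z oz zo] := tri_ex tx.
have H t : e x t -> t != x -> c t = c z.
  move=> xt nt; apply/eqP; apply: contraTT isT => ne.
  suff : bad c x by rewrite (negPf (not_bad x)).
  by apply/badP; exists t, z; split=> //; split=> //; rewrite eq_sym.
by rewrite !H.
Qed.

(* A link between two conflicting blocks takes the repeated colour of these
   blocks, which makes both monochromatic. *)
Let recolour x := if conf c x && conf c (o x) then oc x else c x.

Let kempe_min :
  [/\ forall x, recolour (o x) = recolour x,
      forall x y, ~~ tri x -> e x y -> recolour y = recolour x,
      forall x y z, tri x -> ~~ conf c x -> e x y -> e x z -> y != z ->
        recolour y != recolour z
    & forall x y, conf c x -> conf c (o x) -> e x y ->
        recolour y = recolour x /\ (conf c (o y) -> y = x)].
Proof.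
have [V1 V2] := validP _ cV; split.
- move=> x; rewrite /recolour oK andbC; case: ifP => [/andP[cx cox]|_]; last exact: V1.
  have [y xy yx] := tri_ex (conf_tri cx); have [z oz zo] := tri_ex (conf_tri cox).
  rewrite (@ocP x y) // 1?eq_sym // (@ocP (o x) z) ?oK // 1?eq_sym //.
  apply/eqP; apply: contraTT isT => ne.
  suff : bad c x by rewrite (negPf (not_bad x)).
  by apply/badP; exists y, z; split=> //; split=> //; rewrite eq_sym.
- move=> x y tx xy; have ty : ~~ tri y by rewrite -(tri_eq xy).
  by rewrite /recolour /conf (negPf tx) (negPf ty) /=; apply: V2.
- move=> x y z tx nx xy xz yz.
  rewrite /recolour -(conf_eq c xy) -(conf_eq c xz) (negPf nx) /=.
  exact: (elimT (confPn c tx) nx).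
move=> x y cx cox xy.
(* If [x] and [y] both led to conflicting blocks, then [y] and the third port would share the
   repeated colour by [ocP] at [x], against [link_port] at [y]. *)
have U : conf c (o y) -> y = x.
  move=> coy; apply/eqP; apply/contraT => yx.
  have cy : conf c y by rewrite -(conf_eq c xy).
  have [z [xz zx zy all]] := triP (conf_tri cx) xy yx.
  have yx' : e y x by rewrite eC.
  have := ocP cx cox xy yx; rewrite (ocP cx cox xz zx) => E.
  have := link_port cy coy (not_mono cy coy) (_ : e y z) zy.
  by rewrite -(e_eq xy) E eqxx => /(_ xz).
split=> //; case: (eqVneq y x) => [->//|yx].
rewrite /recolour -(conf_eq c xy) cx cox /= (ocP cx cox xy yx).
by case: ifP => // /U E; rewrite E eqxx in yx.
Qed.

Lemma kempe_minimal : exists (g : X -> 'I_3) (A : pred X),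
  [/\ forall x y, e x y -> A x = A y, forall x, A x -> tri x,
      forall x, g (o x) = g x &
  [/\ forall x y, ~~ tri x -> e x y -> g y = g x,
      forall x y z, tri x -> ~~ A x -> e x y -> e x z -> y != z -> g y != g z
    & forall x y, A x -> A (o x) -> e x y -> g y = g x /\ (A (o y) -> y = x)]].
Proof.
have [K1 K2 K3 K4] := kempe_min; exists recolour, (conf c).
by split=> //; [apply: conf_eq|apply: conf_tri].
Qed.

End Kempe.

(** The predicate [A] marks the blocks that may receive an edge of the fourth colour. The last
    clause says that a marked block linked to another one is monochromatic and has only one such
    link. *)
Lemma kempe_colouring (X : finType) (o : X -> X) (e : rel X) :
  involutive o -> reflexive e -> symmetric e -> transitive e ->
  (forall x, #|[set y | e x y]| <= 3) -> (forall x, tri e x -> ~~ e x (o x)) ->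
  exists (g : X -> 'I_3) (A : pred X),
  [/\ forall x y, e x y -> A x = A y, forall x, A x -> tri e x,
      forall x, g (o x) = g x &
  [/\ forall x y, ~~ tri e x -> e x y -> g y = g x,
      forall x y z, tri e x -> ~~ A x -> e x y -> e x z -> y != z -> g y != g z
    & forall x y, A x -> A (o x) -> e x y -> g y = g x /\ (A (o y) -> y = x)]].
Proof.
move=> oK exx eC eT le3 oN; have [c cV cM] := exists_mu_minimal o e.
exact: (kempe_minimal oK exx eC eT le3 oN cV cM).
Qed.

(** * Cells of claw-free cubic graphs *)

Section Structure.
Variable G : sgraph.
Hypotheses (hclaw : claw_free G) (hcubic : cubic G).

Let adjC (x y : G) : adj x y = adj y x. Proof. exact: adj_sym. Qed.

Lemma adj_neq (x y : G) : adj x y -> x != y.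
Proof. by apply: contraTneq => ->; rewrite adj_irr. Qed.

Lemma third_neighbour (x y z : G) : adj x y -> adj x z -> y != z ->
  exists w, [/\ adj x w, w != y, w != z &
    forall u, adj x u -> [|| u == y, u == z | u == w]].
Proof.
move=> xy xz yz.
have [|||w [wN wy wz all]] := @set3_third _ (neighbours x) y z (hcubic x); rewrite ?inE //.
exists w; split=> //; first by rewrite inE in wN.
by move=> u xu; apply: all; rewrite inE.
Qed.

(** If no two of its three neighbours were adjacent, they would induce a claw together with [x]. *)
Lemma vertex_in_triangle (x : G) : exists y z, [/\ adj x y, adj x z & adj y z].
Proof.
have /card_gt0P[a] : 0 < #|neighbours x| by rewrite hcubic.
rewrite inE => xa.
have : 0 < #|neighbours x :\ a|.
  by have := hcubic x; rewrite (cardsD1 a) inE xa add1n => -[->].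
case/card_gt0P=> b; rewrite !inE => /andP[ba xb].
have [|d [xd da db all]] := third_neighbour xa xb; first by rewrite eq_sym.
case: (boolP (adj a b)) => ab; first by exists a, b.
case: (boolP (adj a d)) => ad; first by exists a, d.
case: (boolP (adj b d)) => bd; first by exists b, d.
exfalso; apply: (hclaw (A := [set x; a; b; d])).
have xa' := adj_neq xa; have xb' := adj_neq xb; have xd' := adj_neq xd.
pose f (v : induced [set x; a; b; d]) : complete_bipartite 1 3 :=
  if val v == x then inl ord0 else
  if val v == a then inr ord0 else if val v == b then inr (inord 1) else inr (inord 2).
have vP (v : induced [set x; a; b; d]) :
    [\/ val v = x /\ f v = inl ord0, val v = a /\ f v = inr ord0,
        val v = b /\ f v = inr (inord 1) | val v = d /\ f v = inr (inord 2)].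
  case: v => v /= vA; rewrite /f /=; move: (vA); rewrite !inE -!orbA.
  case: eqP => [->|_] /=; first by constructor 1.
  case: eqP => [->|_] /=; first by constructor 2.
  case: eqP => [->|_] /=; first by constructor 3.
  by move=> /eqP->; constructor 4.
have n01 : (ord0 : 'I_3) != inord 1 by rewrite -val_eqE /= inordK.
have n02 : (ord0 : 'I_3) != inord 2 by rewrite -val_eqE /= inordK.
have n12 : (inord 1 : 'I_3) != inord 2 by rewrite -val_eqE /= !inordK.
exists f; split.
  apply: inj_card_bij.
    move=> u v fuv; apply: val_inj; move: fuv.
    by case: (vP u) => -[-> ->]; case: (vP v) => -[-> ->] // [] /eqP E //;
       move: E; rewrite ?(negPf n01) ?(negPf n02) ?(negPf n12) // eq_sym
         ?(negPf n01) ?(negPf n02) ?(negPf n12).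
  rewrite card_sum !card_ord card_sig.
  rewrite (eq_card (_ : _ =i [set x; a; b; d])) //.
  rewrite -!setUA !cardsU1 cards1 !inE !negb_or xa' xb' xd'.
  by rewrite [a == b]eq_sym ba [a == d]eq_sym da [b == d]eq_sym db.
move=> u v; rewrite /= /induced_adj.
by case: (vP u) => -[-> ->]; case: (vP v) => -[-> ->] /=; apply/esym;
  rewrite ?adj_irr ?xa ?xb ?xd ?(negPf ab) ?(negPf ad) ?(negPf bd) // adjC
    ?xa ?xb ?xd ?(negPf ab) ?(negPf ad) ?(negPf bd).
Qed.

Definition tadj : rel G := fun x y => adj x y && [exists z, adj x z && adj y z].

Lemma tadj_sym : symmetric tadj.
Proof.
by move=> x y; rewrite /tadj adjC; congr (_ && _); apply: eq_existsb => z; rewrite andbC.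
Qed.

Lemma tadj_intro (x y z : G) : adj x y -> adj x z -> adj y z -> tadj x y.
Proof. by move=> xy xz yz; rewrite /tadj xy; apply/existsP; exists z; rewrite xz. Qed.

Lemma tadj_adj x y : tadj x y -> adj x y. Proof. by case/andP. Qed.

(** Prescribing the full [tadj]-neighbourhoods makes each of the three shapes closed under [tadj],
    hence a whole cell. *)
Definition triangle_cell x y z :=
  [/\ uniq [:: x; y; z], tadj x =1 mem [:: y; z], tadj y =1 mem [:: x; z]
    & tadj z =1 mem [:: x; y]].

(** The vertices [a] and [d] are the tips, [b] and [c] the ends of the central edge. *)
Definition diamond_cell a b c d :=
  [/\ uniq [:: a; b; c; d], tadj a =1 mem [:: b; c], tadj d =1 mem [:: b; c],
      tadj b =1 mem [:: a; c; d] & tadj c =1 mem [:: a; b; d]].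

Definition K4_cell a b c d :=
  [/\ uniq [:: a; b; c; d], tadj a =1 mem [:: b; c; d], tadj b =1 mem [:: a; c; d],
      tadj c =1 mem [:: a; b; d] & tadj d =1 mem [:: a; b; c]].

Lemma tadj3 x y z w : y != z -> w != y -> w != z -> tadj x y -> tadj x z -> tadj x w ->
  tadj x =1 mem [:: y; z; w].
Proof.
move=> yz wy wz xy xz xw u; rewrite /= !inE; apply/idP/idP; last first.
  by case/or3P=> /eqP->.
have [t [xt ty tz all]] := third_neighbour (tadj_adj xy) (tadj_adj xz) yz.
have := all _ (tadj_adj xw); rewrite (negPf wy) (negPf wz) => /eqP->.
by move/tadj_adj/all.
Qed.

(** The edge from [x] to its third neighbour lies in no triangle: the third corner would have to be
    [y] or [z]. *)
Lemma tadj2 x y z : y != z -> tadj x y -> tadj x z ->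
  (forall w, adj x w -> w != y -> w != z -> ~~ adj w y /\ ~~ adj w z) ->
  tadj x =1 mem [:: y; z].
Proof.
move=> yz xy xz H u; rewrite /= !inE; apply/idP/idP; last by case/orP=> /eqP->.
have [t [xt ty tz all]] := third_neighbour (tadj_adj xy) (tadj_adj xz) yz.
move=> xu; apply/contraT; rewrite negb_or => /andP[uy uz].
have ut : u = t.
  by have := all _ (tadj_adj xu); rewrite (negPf uy) (negPf uz) => /eqP.
have [n1 n2] := H _ xt ty tz.
case/andP: xu => _ /existsP[v /andP[/all + uv]].
case/or3P=> /eqP E; move: uv; rewrite ut E ?(negPf n1) ?(negPf n2) //.
by rewrite adj_irr.
Qed.

Lemma diamond_shape a b c d : adj b c -> adj a b -> adj a c -> adj d b -> adj d c ->
  a != d -> ~~ adj a d -> diamond_cell a b c d.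
Proof.
move=> bc ab ac db dc ad nad.
have ba : adj b a by rewrite adjC. have ca : adj c a by rewrite adjC.
have bd : adj b d by rewrite adjC. have cd : adj c d by rewrite adjC.
have cb : adj c b by rewrite adjC.
have nab := adj_neq ab; have nac := adj_neq ac; have ndb := adj_neq db.
have ndc := adj_neq dc; have nbc := adj_neq bc.
have Tba := tadj_intro ba bc ac; have Tbc := tadj_intro bc ba ca.
have Tbd := tadj_intro bd bc dc; have Tca := tadj_intro ca cb ab.
have Tcb := tadj_intro cb ca ba; have Tcd := tadj_intro cd cb db.
have Tab : tadj a b by rewrite tadj_sym. have Tac : tadj a c by rewrite tadj_sym.
have Tdb : tadj d b by rewrite tadj_sym. have Tdc : tadj d c by rewrite tadj_sym.
have Nb : tadj b =1 mem [:: a; c; d] by apply: tadj3; rewrite // eq_sym.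
have Nc : tadj c =1 mem [:: a; b; d] by apply: tadj3; rewrite // eq_sym.
have Ab u : adj b u -> [|| u == a, u == c | u == d].
  have [t [xt ty tz all]] := third_neighbour ba bc nac.
  by have := all _ bd; rewrite eq_sym (negPf ad) (negPf ndc) => /eqP->; apply: all.
have Ac u : adj c u -> [|| u == a, u == b | u == d].
  have [t [xt ty tz all]] := third_neighbour ca cb nab.
  by have := all _ cd; rewrite eq_sym (negPf ad) (negPf ndb) => /eqP->; apply: all.
have nda : ~~ adj d a by rewrite adjC.
split=> //.
- by rewrite /= !inE !negb_or nab nac ad nbc eq_sym ndb eq_sym ndc.
- apply: tadj2 => // w aw wb wc; split; apply/negP; rewrite adjC.
    move/Ab; rewrite (negPf wc) /= => /orP[] /eqP E; move: aw; rewrite E ?adj_irr //.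
    by rewrite (negPf nad).
  move/Ac; rewrite (negPf wb) /= => /orP[] /eqP E; move: aw; rewrite E ?adj_irr //.
  by rewrite (negPf nad).
apply: tadj2 => // w aw wb wc; split; apply/negP; rewrite adjC.
  move/Ab; rewrite (negPf wc) /= => /orP[] /eqP E; move: aw; rewrite E ?adj_irr //.
  by rewrite (negPf nda).
move/Ac; rewrite (negPf wb) /= => /orP[] /eqP E; move: aw; rewrite E ?adj_irr //.
by rewrite (negPf nda).
Qed.

(** Take a triangle at [x] and the outer neighbours of its corners. If all three corners share one,
    the cell is a K4; if exactly two do, a diamond; otherwise the triangle is a cell by itself. *)
Lemma cell_shape x :
  [\/ exists y z, triangle_cell x y z,
      exists a b c d, diamond_cell a b c d /\ x \in [:: a; b; c; d]
    | exists y z w, K4_cell x y z w].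
Proof.
have [y [z [xy xz yz]]] := vertex_in_triangle x.
have yx : adj y x by rewrite adjC. have zx : adj z x by rewrite adjC.
have zy : adj z y by rewrite adjC.
have nxy := adj_neq xy; have nxz := adj_neq xz; have nyz := adj_neq yz.
have nyx := adj_neq yx; have nzx := adj_neq zx; have nzy := adj_neq zy.
have [w [xw wy wz Ax]] := third_neighbour xy xz nyz.
have wx : adj w x by rewrite adjC. have nwx := adj_neq wx.
case: (boolP (adj w y)) => awy.
  have ayw : adj y w by rewrite adjC.
  case: (boolP (adj w z)) => awz.
    have azw : adj z w by rewrite adjC.
    constructor 3; exists y, z, w; split.
    - by rewrite /= !inE !negb_or nxy nxz nyz eq_sym nwx eq_sym wy eq_sym wz.
    - by apply: (tadj3 _ _ _ (tadj_intro xy xz yz) (tadj_intro xz xy zy) (tadj_intro xw xy awy));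
      rewrite // eq_sym.
    - by apply: (tadj3 _ _ _ (tadj_intro yx yz xz) (tadj_intro yz yx zx) (tadj_intro ayw yx wx));
      rewrite // eq_sym.
    - by apply: (tadj3 _ _ _ (tadj_intro zx zy xy) (tadj_intro zy zx yx) (tadj_intro azw zx wx));
      rewrite // eq_sym.
    - by apply: (tadj3 _ _ _ (tadj_intro wx awy xy) (tadj_intro awy wx yx) (tadj_intro awz wx zx));
      rewrite // eq_sym.
  constructor 2; exists z, x, y, w; split; last by rewrite !inE eqxx orbT.
  by apply: diamond_shape; rewrite // ?[z == w]eq_sym // adjC.
case: (boolP (adj w z)) => awz.
  constructor 2; exists y, x, z, w; split; last by rewrite !inE eqxx orbT.
  by apply: diamond_shape; rewrite // ?[y == w]eq_sym // adjC.
have [y' [yy' y'x y'z Ay]] := third_neighbour yx yz nxz.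
have [z' [zz' z'x z'y Az]] := third_neighbour zx zy nxy.
case: (boolP (adj y' z)) => ay'z.
  constructor 2; exists x, y, z, y'; split; last by rewrite !inE eqxx.
  apply: diamond_shape; rewrite // 1?[x == y']eq_sym // 1?adjC //.
  rewrite adjC; apply/negP => /Ax; rewrite (negPf y'z).
  have := adj_neq yy'; rewrite eq_sym => /negPf-> /= /eqP E.
  by rewrite -E ay'z in awz.
constructor 1; exists y, z; split.
- by rewrite /= !inE !negb_or nxy nxz nyz.
- apply: tadj2; rewrite ?(tadj_intro xy xz yz) ?(tadj_intro xz xy zy) //.
  by move=> u /Ax/or3P[] /eqP-> //; rewrite ?eqxx // => _ _; split.
- apply: tadj2; rewrite ?(tadj_intro yx yz xz) ?(tadj_intro yz yx zx) //.
  move=> u /Ay/or3P[] /eqP->; rewrite ?eqxx // => _ _; split=> //.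
  apply/negP; rewrite adjC => /Ax; rewrite (negPf y'z).
  have := adj_neq yy'; rewrite eq_sym => /negPf-> /= /eqP E.
  by rewrite -E adjC yy' in awy.
apply: tadj2; rewrite ?(tadj_intro zx zy xy) ?(tadj_intro zy zx yx) //.
move=> u /Az/or3P[] /eqP->; rewrite ?eqxx // => _ _; split.
  apply/negP; rewrite adjC => /Ax; rewrite (negPf z'y).
  have := adj_neq zz'; rewrite eq_sym => /negPf-> /= /eqP E.
  by rewrite -E adjC zz' in awz.
apply/negP; rewrite adjC => /Ay; rewrite (negPf z'x).
have := adj_neq zz'; rewrite eq_sym => /negPf-> /= /eqP E.
by rewrite -E adjC zz' in ay'z.
Qed.

End Structure.

(** * Links, ports and blocks *)

Section Links.
Variable G : sgraph.
Hypotheses (hclaw : claw_free G) (hcubic : cubic G).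

Let T := @tadj G.
Let Tsym : connect_sym T.
Proof. by apply: sym_connect_sym => x y; apply: tadj_sym. Qed.

Lemma connect_stable (D : seq G) x y :
  (forall u v, u \in D -> T u v -> v \in D) -> x \in D -> connect T x y -> y \in D.
Proof.
move=> H xD /connectP[p]; elim: p x xD => [|v p IH] x xD /=; first by move=> _ ->.
by case/andP=> xv; apply: IH; apply: H xv.
Qed.

Lemma triangle_connect x y z u : triangle_cell x y z ->
  connect T x u = (u \in [:: x; y; z]).
Proof.
case=> _ Tx Ty Tz; apply/idP/idP.
  apply: connect_stable; last by rewrite !inE eqxx.
  move=> v w; rewrite !inE => /or3P[] /eqP->; rewrite /T ?Tx ?Ty ?Tz /= !inE;
  by case/orP=> ->; rewrite ?orbT.
rewrite !inE => /or3P[] /eqP->; first exact: connect0.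
  by apply: connect1; rewrite /T Tx !inE eqxx.
by apply: connect1; rewrite /T Tx !inE eqxx orbT.
Qed.

Lemma diamond_connect a b c d u : diamond_cell a b c d ->
  connect T a u = (u \in [:: a; b; c; d]).
Proof.
case=> _ Ta Td Tb Tc; apply/idP/idP.
  apply: connect_stable; last by rewrite !inE eqxx.
  move=> v w; rewrite !inE => /or4P[] /eqP->; rewrite /T ?Ta ?Tb ?Tc ?Td /= !inE.
  - by case/orP=> ->; rewrite ?orbT.
  - by case/or3P=> ->; rewrite ?orbT.
  - by case/or3P=> ->; rewrite ?orbT.
  - by case/orP=> ->; rewrite ?orbT.
have ab : connect T a b by apply: connect1; rewrite /T Ta !inE eqxx.
rewrite !inE => /or4P[] /eqP-> //.
  by apply: connect1; rewrite /T Ta !inE eqxx orbT.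
by apply: connect_trans ab _; apply: connect1; rewrite /T Tb !inE eqxx !orbT.
Qed.

Lemma K4_connect a b c d u : K4_cell a b c d ->
  connect T a u -> u \in [:: a; b; c; d].
Proof.
case=> _ Ta Tb Tc Td; apply: connect_stable; last by rewrite !inE eqxx.
by move=> v w; rewrite !inE => /or4P[] /eqP->; rewrite /T ?Ta ?Tb ?Tc ?Td /= !inE;
  case/or3P=> ->; rewrite ?orbT.
Qed.

(* By [linked_uniq] a vertex has at most one link; [link x = x] when it has none. *)
Definition linked : rel G := fun x y => adj x y && ~~ tadj x y.
Definition port x := [exists y, linked x y].
Definition link x := odflt x [pick y | linked x y].

Lemma linked_sym : symmetric linked.
Proof. by move=> x y; rewrite /linked adj_sym tadj_sym. Qed.

Lemma linked_uniq x y z : linked x y -> linked x z -> y = z.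
Proof.
case/andP=> xy nxy /andP[xz nxz]; have [u [v [xu xv uv]]] := vertex_in_triangle hclaw hcubic x.
have Tu := tadj_intro xu xv uv.
have Tv : tadj x v by apply: tadj_intro xv xu _; rewrite adj_sym.
have [w [xw wu wv all]] := third_neighbour hcubic xu xv (adj_neq uv).
have H t : adj x t -> ~~ tadj x t -> t = w.
  by move/all/or3P=> [] /eqP->; rewrite ?Tu ?Tv.
by rewrite (H y) // (H z).
Qed.

Lemma linkE x y : linked x y -> link x = y.
Proof.
move=> xy; rewrite /link; case: pickP => [z xz|/(_ y)] /=; last by rewrite xy.
exact: linked_uniq xz xy.
Qed.

Lemma linked_port x y : linked x y -> port x.
Proof. by move=> xy; apply/existsP; exists y. Qed.

Lemma linkP x : port x -> linked x (link x).
Proof. by case/existsP=> y xy; rewrite (linkE xy). Qed.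

Lemma linkN x : ~~ port x -> link x = x.
Proof.
rewrite /link => px; case: pickP => //= y xy; by rewrite (linked_port xy) in px.
Qed.

Lemma linkK : involutive link.
Proof.
move=> x; case: (boolP (port x)) => [px|px]; last by rewrite !linkN.
by apply: linkE; rewrite linked_sym; apply: linkP.
Qed.

Lemma port2 x y z : y != z -> tadj x =1 mem [:: y; z] -> port x.
Proof.
move=> yz Tx.
have xy : adj x y by apply: tadj_adj; rewrite Tx !inE eqxx.
have xz : adj x z by apply: tadj_adj; rewrite Tx !inE eqxx orbT.
have [w [xw wy wz _]] := third_neighbour hcubic xy xz yz.
by apply: (@linked_port x w); rewrite /linked xw Tx !inE negb_or wy.
Qed.

Lemma nport3 x y z w : uniq [:: y; z; w] -> tadj x =1 mem [:: y; z; w] -> ~~ port x.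
Proof.
rewrite /= !inE negb_or andbT => /andP[/andP[yz yw] zw] Tx; apply/existsP=> -[u /andP[xu]].
have xy : adj x y by apply: tadj_adj; rewrite Tx !inE eqxx.
have xz : adj x z by apply: tadj_adj; rewrite Tx !inE eqxx orbT.
have xw : adj x w by apply: tadj_adj; rewrite Tx !inE eqxx !orbT.
have [t [xt ty tz all]] := third_neighbour hcubic xy xz yz.
have := all _ xw; rewrite eq_sym (negPf yw) [w == z]eq_sym (negPf zw) => /eqP E.
by rewrite Tx !inE E all.
Qed.

(** A vertex without a link is a block of its own, which makes this an equivalence on all of [G], as
    the Kempe argument requires. *)
Definition block : rel G := fun x y => (x == y) || [&& port x, port y & connect T x y].

Lemma block_refl : reflexive block. Proof. by move=> x; rewrite /block eqxx. Qed.
Lemma block_sym : symmetric block.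
Proof. by move=> x y; rewrite /block eq_sym Tsym andbCA. Qed.
Lemma block_trans : transitive block.
Proof.
move=> y x z; rewrite /block => /orP[/eqP->//|/and3P[px py xy]].
case/orP=> [/eqP<-|/and3P[_ pz yz]]; first by rewrite px py xy orbT.
by rewrite px pz (connect_trans xy yz) orbT.
Qed.

Lemma triangle_ports x y z : triangle_cell x y z -> [/\ port x, port y & port z].
Proof.
case; rewrite /= !inE negb_or andbT => /andP[/andP[xy xz] yz] Tx Ty Tz.
by split; [apply: port2 Tx|apply: port2 Ty|apply: port2 Tz].
Qed.

Lemma triangle_block x y z : triangle_cell x y z -> block x =1 mem [:: x; y; z].
Proof.
move=> xyz u; have [px py pz] := triangle_ports xyz.
rewrite /block px (triangle_connect _ xyz) !inE eq_sym.
case: (eqVneq u x) => //= _.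
by case: (eqVneq u y) => [->|_] /=; [rewrite py|case: (eqVneq u z) => [->|_]; rewrite ?pz ?andbF].
Qed.

Lemma nport_block x y : ~~ port x -> block x y = (x == y).
Proof. by rewrite /block => /negPf->; rewrite orbF. Qed.

Lemma diamond_ports a b c d : diamond_cell a b c d ->
  [/\ port a, port d, ~~ port b & ~~ port c].
Proof.
case; rewrite /= !inE !negb_or -!andbA => /and5P[ab ac ad bc /andP[bd /andP[cd _]]] Ta Td Tb Tc.
split; [exact: port2 Ta|exact: port2 Td| |].
  by apply: nport3 Tb; rewrite /= !inE negb_or ac ad cd.
by apply: nport3 Tc; rewrite /= !inE negb_or ab ad bd.
Qed.

(** A diamond has only its two tips as ports and a K4 has none, so only triangles yield three
    ports. *)
Lemma block_cases x :
  (exists y z, triangle_cell x y z) \/ #|[set y | block x y]| <= 2.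
Proof.
have npc : ~~ port x -> #|[set y | block x y]| <= 2.
  move=> px; apply: (@leq_trans #|[set x]|); last by rewrite cards1.
  by apply: subset_leq_card; apply/subsetP=> y; rewrite !inE nport_block // eq_sym.
case: (cell_shape hclaw hcubic x); first by left.
  case=> a [b [c [d [abcd xin]]]]; right.
  have [pa pd pb pc] := diamond_ports abcd.
  case: (boolP (port x)) => [px|//].
  apply: (@leq_trans #|[set a; d]|); last by rewrite cards2; case: (_ != _).
  apply: subset_leq_card; apply/subsetP=> y; rewrite !inE => xy.
  have /and3P[py _ ay] : [&& port y, port a & connect T a y].
    move: xin; rewrite -(diamond_connect _ abcd) pa => ax.
    by case/orP: xy => [/eqP<-|/and3P[_ -> /(connect_trans ax)->]]; rewrite ?px ?ax.
  move: ay; rewrite (diamond_connect _ abcd) !inE => /or4P[] /eqP E; rewrite E ?eqxx ?orbT //.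
    by rewrite E (negPf pb) in py.
  by rewrite E (negPf pc) in py.
case=> y [z [w [U Tx _ _ _]]]; right; apply: npc; apply: nport3 Tx.
by case/andP: U.
Qed.

Lemma block_le3 x : #|[set y | block x y]| <= 3.
Proof.
case: (block_cases x) => [[y [z xyz]]|/leq_trans->//].
apply: (@leq_trans #|[set x; y; z]|).
  by apply: subset_leq_card; apply/subsetP=> u; rewrite !inE (triangle_block xyz) /= !inE orbA.
by rewrite -setUA cardsU1 cards2; case: (_ \notin _); case: (_ != _).
Qed.

Lemma tri_block x : tri block x -> exists y z, triangle_cell x y z.
Proof. by rewrite /tri; case: (block_cases x) => // + /eqP E; rewrite E. Qed.

Lemma triangle_tri x y z : triangle_cell x y z -> tri block x.
Proof.
move=> xyz; case: (xyz); rewrite /= !inE negb_or andbT => /andP[/andP[xy xz] yz] _ _ _.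
have -> : tri block x = (#|[set x; y; z]| == 3).
  rewrite /tri; congr (#|pred_of_set _| == _); apply/setP=> u.
  by rewrite !inE (triangle_block xyz) /= !inE orbA.
by rewrite -setUA cardsU1 cards2 !inE negb_or xy xz yz.
Qed.

Lemma tri_link x : tri block x -> ~~ block x (link x).
Proof.
case/tri_block=> y [z xyz]; have [px _ _] := triangle_ports xyz.
rewrite (triangle_block xyz); have /andP[ad nT] := linkP px.
case: (xyz) => _ Tx _ _; move: nT; rewrite Tx !inE negb_or => /andP[/negPf-> /negPf->].
by rewrite eq_sym (negPf (adj_neq ad)).
Qed.

End Links.

(** * Extending the colouring of the links *)

(* [a], [b], [d] are the colours of the links at the corners of a triangle and
   [f1], [f2], [f3] the colours of the respective opposite edges. *)
Lemma triangle_fill (a b d : 'I_3) : exists p : nat * nat * nat,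
  let: (f1, f2, f3) := p in
  [/\ [&& f1 < 4, f2 < 4 & f3 < 4], uniq [:: f1; f2; f3],
      [&& f1 != b, f1 != d, f2 != a, f2 != d, f3 != a & f3 != b],
      (a == b) && (a == d) -> f1 = 3
    & uniq [:: a; b; d] -> [&& f1 != 3, f2 != 3 & f3 != 3]].
Proof.
pose s := iota 0 4.
pose P (p : nat * nat * nat) := let: (f1, f2, f3) := p in
  [&& [&& f1 < 4, f2 < 4 & f3 < 4], uniq [:: f1; f2; f3],
      [&& f1 != b, f1 != d, f2 != a, f2 != d, f3 != a & f3 != b],
      ((a == b) && (a == d)) ==> (f1 == 3)
    & uniq [:: a; b; d] ==> [&& f1 != 3, f2 != 3 & f3 != 3]].
(* For each of the 27 triples of link colours, a search among the 64 candidates succeeds by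
   computation. *)
have /hasP[[[f1 f2] f3] _ /and5P[h1 h2 h3 /implyP h4 /implyP h5]] :
    has P [seq (p, z) | p <- [seq (x, y) | x <- s, y <- s], z <- s].
  rewrite {}/P; case: a => [[|[|[|//]]] ?]; case: b => [[|[|[|//]]] ?];
  by case: d => [[|[|[|//]]] ?].
by exists (f1, f2, f3); split=> // /h4/eqP.
Qed.

Section Local.
Variable G : sgraph.
Hypotheses (hclaw : claw_free G) (hcubic : cubic G).
Variables (g : G -> 'I_3) (A : pred G).
Let T := @tadj G.
Let o := @link G.
Let e := @block G.
Hypothesis A_eq : forall x y, e x y -> A x = A y.
Hypothesis g_ntri : forall x y, ~~ tri e x -> e x y -> g y = g x.
Hypothesis g_tri : forall x y z, tri e x -> ~~ A x -> e x y -> e x z -> y != z -> g y != g z.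
Hypothesis g_A : forall x y, A x -> A (o x) -> e x y -> g y = g x /\ (A (o y) -> y = x).

Let Tsym : connect_sym T.
Proof. by apply: sym_connect_sym => x y; apply: tadj_sym. Qed.

(* Colours are [0], [1], [2] and [3], where [3] stands for the sparse class [E_4]. *)
Definition local_colouring (f : {set G} -> nat) x :=
  [/\ forall d, f d < 4,
      forall u v w, connect T x u -> T u v -> T u w -> v != w ->
        f [set u; v] != f [set u; w],
      forall u v, connect T x u -> T u v -> port u -> f [set u; v] != g u,
      forall u v u' v', connect T x u -> connect T x u' -> T u v -> T u' v' ->
        f [set u; v] = 3 -> f [set u'; v'] = 3 -> [set u; v] = [set u'; v']
    & forall u v, connect T x u -> T u v -> f [set u; v] = 3 -> A u && ~~ A (o u)].

Lemma local_connect f x y : connect T x y -> local_colouring f y -> local_colouring f x.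
Proof.
move=> xy; have H u : connect T x u -> connect T y u.
  by rewrite Tsym => /connect_trans/(_ xy); rewrite Tsym.
case=> L0 L1 L2 L3 L4; split=> //.
- by move=> u v w /H; apply: L1.
- by move=> u v /H; apply: L2.
- by move=> u v u' v' /H xu /H; apply: L3.
- by move=> u v /H; apply: L4.
Qed.

(** In a marked triangle only the link at [x] may lead to a marked block. If it does, the link
    colours agree and [triangle_fill] puts colour 3 on the edge opposite to [x], away from that
    link. *)
Lemma triangle_local x y z : triangle_cell x y z ->
  (A x -> ~~ A (o y) && ~~ A (o z)) -> exists f, local_colouring f x.
Proof.
move=> xyz Ayz; have [U Tx Ty Tz] := xyz.
have [px py pz] := triangle_ports hcubic xyz.
have bx := triangle_block hcubic xyz.
move: (U); rewrite /= !inE negb_or andbT => /andP[/andP[xy xz] yz].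
have yx : y != x by rewrite eq_sym.
have zx : z != x by rewrite eq_sym.
have zy : z != y by rewrite eq_sym.
have Axy : A x = A y by apply: A_eq; rewrite /e bx !inE eqxx orbT.
have Axz : A x = A z by apply: A_eq; rewrite /e bx !inE eqxx !orbT.
have [[[f1 f2] f3] [/and3P[b1 b2 b3] fU fne f13 fn3]] := triangle_fill (g x) (g y) (g z).
pose f (d : {set G}) := if x \notin d then f1 else if y \notin d then f2 else f3.
have Fyz : f [set y; z] = f1 by rewrite /f !inE (negPf xy) (negPf xz).
have Fxz : f [set x; z] = f2 by rewrite /f !inE eqxx (negPf yx) (negPf yz).
have Fxy : f [set x; y] = f3 by rewrite /f !inE !eqxx orbT.
have Fzy : f [set z; y] = f1 by rewrite setUC.
have Fzx : f [set z; x] = f2 by rewrite setUC.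
have Fyx : f [set y; x] = f3 by rewrite setUC.
have FE := (Fyz, Fxz, Fxy, Fzy, Fzx, Fyx).
move: fU; rewrite /= !inE negb_or andbT => /andP[/andP[n12 n13] n23].
have n21 : f2 != f1 by rewrite eq_sym. have n31 : f3 != f1 by rewrite eq_sym.
have n32 : f3 != f2 by rewrite eq_sym.
case/and5P: fne => ? ? ? ? /andP[? ?].
have C u : connect T x u -> [|| u == x, u == y | u == z].
  by rewrite /T (triangle_connect _ xyz) !inE.
have A3 : [|| f1 == 3, f2 == 3 | f3 == 3] -> A x.
  apply: contraLR => nA; rewrite !negb_or; apply: fn3.
  have tx := triangle_tri hcubic xyz.
  rewrite /= !inE negb_or andbT -andbA; apply/and3P.
  by split; apply: (g_tri tx nA); rewrite // /e bx !inE eqxx ?orbT.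
have A2 : A x -> A (o x) -> f1 = 3.
  move=> Ax Aox; apply: f13.
  have [|-> _] := g_A Ax Aox (_ : e x y); first by rewrite /e bx !inE eqxx orbT.
  have [|-> _] := g_A Ax Aox (_ : e x z); first by rewrite /e bx !inE eqxx !orbT.
  by rewrite eqxx.
exists f; split.
- by move=> d; rewrite /f; case: ifP => // _; case: ifP.
- move=> u v w /C/or3P[] /eqP->; rewrite /T ?Tx ?Ty ?Tz /= !inE => /orP[] /eqP-> /orP[] /eqP->;
  by rewrite ?eqxx // !FE.
- by move=> u v /C/or3P[] /eqP->; rewrite /T ?Tx ?Ty ?Tz /= !inE => /orP[] /eqP->; rewrite !FE.
- have key u v : connect T x u -> T u v ->
    [\/ f [set u; v] = f1 /\ [set u; v] = [set y; z],
        f [set u; v] = f2 /\ [set u; v] = [set x; z] |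
        f [set u; v] = f3 /\ [set u; v] = [set x; y]].
    move=> /C/or3P[] /eqP->; rewrite /T ?Tx ?Ty ?Tz /= !inE => /orP[] /eqP->; rewrite !FE.
    + by constructor 3.
    + by constructor 2.
    + by constructor 3; rewrite setUC.
    + by constructor 1.
    + by constructor 2; rewrite setUC.
    + by constructor 1; rewrite setUC.
  move=> u v u' v' xu xu' uv uv'.
  case: (key _ _ xu uv) => -[-> ->]; case: (key _ _ xu' uv') => -[-> ->] // E1 E2.
  + by rewrite E1 E2 eqxx in n12.
  + by rewrite E1 E2 eqxx in n13.
  + by rewrite E1 E2 eqxx in n12.
  + by rewrite E1 E2 eqxx in n23.
  + by rewrite E1 E2 eqxx in n13.
  + by rewrite E1 E2 eqxx in n23.
move=> u v xu uv E.
have Ax : A x.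
  apply: A3; move: E; move: xu uv => /C/or3P[] /eqP->;
  by rewrite /T ?Tx ?Ty ?Tz /= !inE => /orP[] /eqP->; rewrite !FE => ->; rewrite eqxx ?orbT.
have /andP[Ay Az] := Ayz Ax.
case/C/or3P: xu => /eqP Eu; rewrite Eu ?Ay ?Az -?Axy -?Axz Ax //.
apply/negP => /(A2 Ax) E1; move: uv E; rewrite Eu /T Tx !inE => /orP[] /eqP->; rewrite !FE => E.
  by rewrite E1 E eqxx in n13.
by rewrite E1 E eqxx in n12.
Qed.

(** The common link colour of the tips goes on the central edge, and the other two colours alternate
    around the outer 4-cycle. *)
Lemma diamond_local a b c d : diamond_cell a b c d -> exists f, local_colouring f a.
Proof.
move=> abcd; have [U Ta Td Tb Tc] := abcd.
have [pa pd pb pc] := diamond_ports hcubic abcd.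
have C u : connect T a u -> [|| u == a, u == b, u == c | u == d].
  by rewrite /T (diamond_connect _ abcd) !inE.
have gad : g d = g a.
  have ead : e a d.
    by rewrite /e /block pa pd /= (diamond_connect _ abcd) !inE eqxx !orbT.
  case: (boolP (tri e a)) => ta; last exact: g_ntri.
  have [y [z ayz]] := tri_block hclaw hcubic ta.
  have [_ py pz] := triangle_ports hcubic ayz; case: ayz => _ Ta' _ _.
  have := Ta b; rewrite Ta' !inE eqxx => /orP[] /eqP E.
    by rewrite E py in pb.
  by rewrite E pz in pb.
have [k' k'g] : exists k, g a != k.
  have : 0 < #|~: [set g a]| by rewrite cardsC1 card_ord.
  by case/card_gt0P => k; rewrite !inE => H; exists k; rewrite eq_sym.
have [j' j'g j'k] := ord3_third k'g.
pose i : nat := g a; pose j : nat := j'; pose k : nat := k'.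
have lt3 (m : 'I_3) : m != 3 :> nat by rewrite neq_ltn ltn_ord.
have ij : i != j by rewrite eq_sym.
have ik : i != k by [].
have jk : j != k by [].
have ji : j != i by rewrite eq_sym. have ki : k != i by rewrite eq_sym.
have kj : k != j by rewrite eq_sym.
move: (U); rewrite /= !inE !negb_or -!andbA => /and5P[ab ac ad bc /andP[bd /andP[cd _]]].
have ba : b != a by rewrite eq_sym. have ca : c != a by rewrite eq_sym.
have da : d != a by rewrite eq_sym. have cb : c != b by rewrite eq_sym.
have db : d != b by rewrite eq_sym. have dc : d != c by rewrite eq_sym.
pose f (s : {set G}) := if a \in s then (if b \in s then j else k)
  else if d \in s then (if c \in s then j else k) else i.
have NE := (eqxx, negPf ab, negPf ac, negPf ad, negPf bc, negPf bd, negPf cd,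
            negPf ba, negPf ca, negPf da, negPf cb, negPf db, negPf dc).
have Fab : f [set a; b] = j by rewrite /f !inE !NE.
have Fac : f [set a; c] = k by rewrite /f !inE !NE.
have Fbd : f [set b; d] = k by rewrite /f !inE !NE.
have Fcd : f [set c; d] = j by rewrite /f !inE !NE.
have Fbc : f [set b; c] = i by rewrite /f !inE !NE.
have Fba : f [set b; a] = j by rewrite setUC. have Fca : f [set c; a] = k by rewrite setUC.
have Fdb : f [set d; b] = k by rewrite setUC. have Fdc : f [set d; c] = j by rewrite setUC.
have Fcb : f [set c; b] = i by rewrite setUC.
have FE := (Fab, Fac, Fbd, Fcd, Fbc, Fba, Fca, Fdb, Fdc, Fcb).
have fn3 s : f s != 3 by rewrite /f; repeat case: ifP => _; apply: lt3.
exists f; split.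
- have lt4 (m : 'I_3) : m < 4 by apply: ltn_trans (ltn_ord m) _.
  by move=> s; rewrite /f; repeat case: ifP => _; apply: lt4.
- move=> u v w /C/or4P[] /eqP->; rewrite /T ?Ta ?Tb ?Tc ?Td /= !inE.
  + by move=> /orP[] /eqP-> /orP[] /eqP->; rewrite ?eqxx // !FE.
  + by move=> /or3P[] /eqP-> /or3P[] /eqP->; rewrite ?eqxx // !FE.
  + by move=> /or3P[] /eqP-> /or3P[] /eqP->; rewrite ?eqxx // !FE.
  + by move=> /orP[] /eqP-> /orP[] /eqP->; rewrite ?eqxx // !FE.
- move=> u v /C/or4P[] /eqP->; rewrite /T ?Ta ?Td ?(negPf pb) ?(negPf pc) //= !inE.
  + by move=> /orP[] /eqP-> _; rewrite !FE.
  + by move=> /orP[] /eqP-> _; rewrite !FE gad.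
- by move=> u v u' v' _ _ _ _ E; have := fn3 [set u; v]; rewrite E.
by move=> u v _ _ E; have := fn3 [set u; v]; rewrite E.
Qed.

Lemma K4_local a b c d : K4_cell a b c d -> exists f, local_colouring f a.
Proof.
move=> abcd; have [U Ta Tb Tc Td] := abcd.
have C u : connect T a u -> [|| u == a, u == b, u == c | u == d].
  by move/(K4_connect abcd); rewrite !inE.
move: (U); rewrite /= !inE !negb_or -!andbA => /and5P[ab ac ad bc /andP[bd /andP[cd _]]].
have ba : b != a by rewrite eq_sym. have ca : c != a by rewrite eq_sym.
have da : d != a by rewrite eq_sym. have cb : c != b by rewrite eq_sym.
have db : d != b by rewrite eq_sym. have dc : d != c by rewrite eq_sym.
have np u : connect T a u -> ~~ port u.
  move/C/or4P=> [] /eqP->.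
  - by apply: (nport3 hcubic _ Ta); rewrite /= !inE negb_or bc bd cd.
  - by apply: (nport3 hcubic _ Tb); rewrite /= !inE negb_or ac ad cd.
  - by apply: (nport3 hcubic _ Tc); rewrite /= !inE negb_or ab ad bd.
  - by apply: (nport3 hcubic _ Td); rewrite /= !inE negb_or ab ac bc.
(* The classes are the three perfect matchings of the K4, told apart by the vertex on the same side
   of the edge as [a]. *)
pose f (s : {set G}) := if (a \in s) == (b \in s) then 0
  else if (a \in s) == (c \in s) then 1 else 2.
have NE := (eqxx, negPf ab, negPf ac, negPf ad, negPf bc, negPf bd, negPf cd,
            negPf ba, negPf ca, negPf da, negPf cb, negPf db, negPf dc).
have fn3 s : f s != 3 by rewrite /f; repeat case: ifP => _.
exists f; split.
- by move=> s; rewrite /f; repeat case: ifP => _.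
- move=> u v w /C/or4P[] /eqP->; rewrite /T ?Ta ?Tb ?Tc ?Td /= !inE;
  by move=> /or3P[] /eqP-> /or3P[] /eqP->; rewrite ?eqxx // /f !inE !NE.
- by move=> u v /np/negPf->.
- by move=> u v u' v' _ _ _ _ E; have := fn3 [set u; v]; rewrite E.
by move=> u v _ _ E; have := fn3 [set u; v]; rewrite E.
Qed.

Lemma triangle_rot (x y z : G) : triangle_cell x y z -> triangle_cell y z x.
Proof.
case; rewrite /= !inE negb_or andbT => /andP[/andP[xy xz] yz] Tx Ty Tz.
split=> //; first by rewrite /= !inE negb_or yz ![_ == x]eq_sym xy xz.
  by move=> u; rewrite Ty !inE orbC.
by move=> u; rewrite Tz !inE orbC.
Qed.

(** By [g_A], at most one corner of a marked triangle is linked to a marked block; the triangle is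
    rotated to list that corner first. *)
Lemma exists_local x : exists f, local_colouring f x.
Proof.
case: (cell_shape hclaw hcubic x) => [[y [z xyz]]|[a [b [c [d [abcd xin]]]]]|[y [z [w K]]]].
- have yzx := triangle_rot xyz; have zxy := triangle_rot yzx.
  have bx := triangle_block hcubic xyz.
  have by_ := triangle_block hcubic yzx; have bz := triangle_block hcubic zxy.
  have [U _ _ _] := xyz.
  move: (U); rewrite /= !inE negb_or andbT => /andP[/andP[xy xz] yz].
  have exy : e x y by rewrite /e bx !inE eqxx orbT.
  have exz : e x z by rewrite /e bx !inE eqxx !orbT.
  have eyz : e y z by rewrite /e by_ !inE eqxx orbT.
  have eyx : e y x by rewrite /e by_ !inE eqxx !orbT.
  have ezx : e z x by rewrite /e bz !inE eqxx orbT.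
  have ezy : e z y by rewrite /e bz !inE eqxx !orbT.
  have cxy : connect T x y by rewrite /T (triangle_connect _ xyz) !inE eqxx orbT.
  have cxz : connect T x z by rewrite /T (triangle_connect _ xyz) !inE eqxx !orbT.
  have H u v : e u v -> u != v -> A u -> A (o u) -> ~~ A (o v).
    move=> uv nuv Au Aou; have [_ H] := g_A Au Aou uv.
    by apply/negP => /H E; rewrite E eqxx in nuv.
  have [Ay|Ay] := boolP (A y && A (o y)).
    have [|f L] := triangle_local yzx; last by exists f; apply: local_connect L.
    by case/andP: Ay => Ay Aoy _; rewrite !(H y) // eq_sym.
  have [Az|Az] := boolP (A z && A (o z)).
    have [|f L] := triangle_local zxy; last by exists f; apply: local_connect L.
    by case/andP: Az => Az Aoz _; rewrite !(H z) // eq_sym.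
  apply: triangle_local xyz _ => Ax.
  by move: Ay Az; rewrite -(A_eq exy) -(A_eq exz) Ax /= => -> ->.
- have [f L] := diamond_local abcd; exists f; apply: local_connect L.
  by rewrite Tsym /T (diamond_connect _ abcd).
exact: K4_local K.
Qed.

End Local.

(** * The global colouring and distances in the line graph *)

Definition near (G : sgraph) : rel G := fun x y => (x == y) || adj x y.

Lemma set2_inj (T : finType) (x y u v : T) : [set x; y] = [set u; v] ->
  (x = u /\ y = v) \/ (x = v /\ y = u).
Proof.
move=> E.
have := set21 x y; rewrite E !inE => /orP[] /eqP Ex.
  left; split=> //; have := set22 x y; rewrite E !inE => /orP[] /eqP // Ey.
  by have := set22 u v; rewrite -E !inE Ex Ey orbb => /eqP.
right; split=> //; have := set22 x y; rewrite E !inE => /orP[] /eqP // Ey.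
by have := set21 u v; rewrite -E !inE Ex Ey orbb => /eqP.
Qed.

Lemma exists_vertex_colouring (G : sgraph) : claw_free G -> cubic G ->
  exists phi : G -> G -> nat,
  [/\ forall x y, adj x y -> phi x y < 4,
      forall x y, adj x y -> phi x y = phi y x,
      forall x y z, adj x y -> adj x z -> y != z -> phi x y != phi x z
    & forall p p' q r r', adj p p' -> adj r r' -> phi p p' = 3 -> phi r r' = 3 ->
        near p q -> near q r -> [set p; p'] = [set r; r']].
Proof.
move=> hclaw hcubic.
have [g [A [A_eq A_tri g_link [g_ntri g_tri g_A]]]] :=
  kempe_colouring (linkK hclaw hcubic) (@block_refl G) (@block_sym G)
    (@block_trans G) (block_le3 hclaw hcubic) (tri_link hclaw hcubic).
have [F FL] := fin_all_exists (exists_local hclaw hcubic A_eq g_ntri g_tri g_A).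
have Tsym : connect_sym (@tadj G).
  by apply: sym_connect_sym => x y; apply: tadj_sym.
(* Taking the root of the component selects one local colouring per cell; links keep their colour
   from [g]. *)
pose T := @tadj G; pose phi x y := if T x y then F (root T x) [set x; y] else g x : nat.
have rx x : connect T (root T x) x by rewrite Tsym connect_root.
have rE x y : connect T x y -> root T x = root T y by move=> xy; apply/eqP; rewrite root_connect.
have lE := linkE hclaw hcubic.
have lk x y : adj x y -> ~~ T x y -> linked x y by move=> xy nT; rewrite /linked xy.
have phi3 x y : adj x y -> phi x y = 3 -> T x y.
  by rewrite /phi; case: ifP => // _ _ E; have := ltn_ord (g x); rewrite E.
have port_A x : A x -> port x.
  by case/A_tri/(tri_block hclaw hcubic) => y [z /(triangle_ports hcubic)[]].
have phiA x y : adj x y -> phi x y = 3 -> A x && ~~ A (link x).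
  move=> xy E; have Txy := phi3 _ _ xy E; have [_ _ _ _ L4] := FL (root T x).
  by apply: (L4 x y) => //; move: E; rewrite /phi Txy.
have Ac x y : A x -> connect T x y -> port y -> A y.
  by move=> Ax xy py; rewrite -(A_eq x y) // /block py xy port_A // orbT.
exists phi; split.
- move=> x y _; rewrite /phi; case: ifP => _; first by have [->] := FL (root T x).
  exact: ltn_trans (ltn_ord _) _.
- move=> x y xy; rewrite /phi /T [tadj y x]tadj_sym -/T; case: ifP => [Txy|/negbT nT].
    by rewrite setUC (rE x y) // connect1.
  by rewrite -(g_link x) (lE x y) // lk.
- move=> x y z xy xz yz; have [_ L1 L2 _ _] := FL (root T x); rewrite /phi.
  case: ifP => [Txy|/negbT nxy]; case: ifP => [Txz|/negbT nxz].
  + exact: L1.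
  + by apply: L2 => //; apply: linked_port (lk _ _ xz nxz).
  + by rewrite eq_sym; apply: L2 => //; apply: linked_port (lk _ _ xy nxy).
  + by move: yz; rewrite (linked_uniq hclaw hcubic (lk _ _ xy nxy) (lk _ _ xz nxz)) eqxx.
move=> p p' q r r' pp' rr' Ep Er pq qr.
have Tp := phi3 _ _ pp' Ep; have Tr := phi3 _ _ rr' Er.
have /andP[Ap Alp] := phiA _ _ pp' Ep; have /andP[Ar Alr] := phiA _ _ rr' Er.
have [pr|npr] := boolP (connect T p r).
  have [_ _ _ L3 _] := FL (root T p).
  apply: L3 => //; first by apply: connect_trans (rx p) pr.
    by move: Ep; rewrite /phi Tp.
  by move: Er; rewrite /phi Tr (rE p r).
exfalso.
(* A link between the two cells joins two marked blocks, whereas an end of an edge of colour 3 is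
   never linked to a marked block. *)
have cross u v : connect T p u -> connect T r v -> linked u v -> ~~ (p == u) /\ ~~ (r == v).
  move=> pu rv uv; have vu : linked v u by rewrite linked_sym.
  have Au := Ac _ _ Ap pu (linked_port uv); have Av := Ac _ _ Ar rv (linked_port vu).
  split; apply/negP=> /eqP E.
    by move: Alp; rewrite E (lE u v) // Av.
  by move: Alr; rewrite E (lE v u) // Au.
have nT u v : connect T p u -> connect T r v -> ~~ T u v.
  move=> pu rv; apply: contra npr => uv.
  apply: connect_trans pu _; apply: connect_trans (connect1 uv) _; by rewrite Tsym.
have step u v : connect T p u -> connect T r v -> near u v -> linked u v.
  move=> pu rv /orP[/eqP E|uv]; last by apply: lk => //; apply: nT.
  by case/negP: npr; apply: connect_trans pu _; rewrite E Tsym.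
have [pq'|npq] := boolP (connect T p q).
  have /(cross _ _ pq' (connect0 _ _))[_] := step q r pq' (connect0 _ _) qr.
  by rewrite eqxx.
have [rq'|nrq] := boolP (connect T r q).
  have /(cross _ _ (connect0 _ _) rq')[] := step p q (connect0 _ _) rq' pq.
  by rewrite eqxx.
(* A middle vertex [q] outside both cells is joined to [p] and to [r] by links, so [linked_uniq]
   identifies [p] with [r]. *)
have qp : linked q p.
  rewrite linked_sym; case/orP: pq => [/eqP E|/lk]; first by rewrite E connect0 in npq.
  by apply; apply: contra npq; apply: connect1.
have qr' : linked q r.
  case/orP: qr => [/eqP E|]; first by rewrite E connect0 in nrq.
  rewrite adj_sym linked_sym => /lk.
  by apply; apply: contra nrq; apply: connect1.
by move: npr; rewrite (linked_uniq hclaw hcubic qp qr') connect0.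
Qed.

(** Consecutive edges of the walk share a vertex, and shared vertices on one inner edge are [near].
    There are at most two inner edges, hence at most two steps from [p] to [r]. *)
Lemma line_walk_near (G : sgraph) (e f : line_graph G) n : walk_of_length e f n -> n <= 3 ->
  e != f -> exists p q r, [/\ p \in val e, r \in val f, near p q & near q r].
Proof.
have edge_near (d : line_graph G) x y : x \in val d -> y \in val d -> near x y.
  case: d => d /=; rewrite inE => /existsP[u /existsP[v /andP[uv /eqP->]]].
  have vu : adj v u by rewrite adj_sym.
  by rewrite !inE => /orP[] /eqP-> /orP[] /eqP->; rewrite /near ?eqxx ?uv ?vu ?orbT.
have common (d d' : line_graph G) : adj d d' -> exists2 x, x \in val d & x \in val d'.
  by case/andP=> _ /set0Pn[x]; rewrite inE => /andP[]; exists x.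
have nearxx (x : G) : near x x by rewrite /near eqxx.
case=> [[|d1 [|d2 [|d3 [|? ?]]]] [+ <- <-]] //=; rewrite ?eqxx //.
- by case/andP=> /common[x xe xd] _ _ _; exists x, x, x.
- case/and3P=> /common[x xe xd1] /common[y yd1 yd2] _ _ _.
  by exists x, x, y; split=> //; apply: edge_near yd1.
- case/and4P=> /common[x xe xd1] /common[y yd1 yd2] /common[z zd2 zd3] _ _ _.
  by exists x, y, z; split=> //; [apply: edge_near yd1|apply: edge_near zd2].
Qed.

Theorem theorem2p4 (G : sgraph) (h2 : two_edge_connected G)
    (hclaw : claw_free G) (hcubic : cubic G) :
  packing_edge_colorable G [:: 1; 1; 1; 3].
Proof.
have [phi [phi4 phiC phiN phiD]] := exists_vertex_colouring hclaw hcubic.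
(* Symmetry of [phi] makes the picked orientation of an edge immaterial, and the default 0 is only
   taken on sets that are not edges. *)
pose psi (d : {set G}) := odflt 0 (omap (fun p => phi p.1 p.2)
  [pick p : G * G | adj p.1 p.2 && ([set p.1; p.2] == d)]).
have psiE x y : adj x y -> psi [set x; y] = phi x y.
  move=> xy; rewrite /psi; case: pickP => [[u v] /= /andP[uv /eqP E]|/(_ (x, y))] /=.
    by case: (set2_inj E) => -[-> ->] //; apply/esym/phiC.
  by rewrite xy eqxx.
have edgeP (d : line_graph G) x : x \in val d -> exists2 y, adj x y & val d = [set x; y].
  case: d => d /=; rewrite inE => /existsP[u /existsP[v /andP[uv /eqP->]]].
  rewrite !inE => /orP[] /eqP->; first by exists v.
  by exists u; rewrite 1?adj_sym // setUC.
have psi4 (d : line_graph G) : psi (val d) < 4.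
  have [x xd] : exists x, x \in val d.
    case: d => d /=; rewrite inE => /existsP[u /existsP[v /andP[_ /eqP->]]].
    by exists u; rewrite !inE eqxx.
  by have [y xy ->] := edgeP _ _ xd; rewrite psiE // phi4.
exists (fun i => [set d : line_graph G | psi (val d) == i :> nat]); split=> [d|i d d' +].
  exists (Ordinal (psi4 d)); split=> [|i]; rewrite inE /=; first exact: eqxx.
  by move/eqP=> E; apply: val_inj.
move=> di d'i ndd' n [wk _]; move: di d'i; rewrite !inE => /eqP di /eqP d'i.
(* Edges at distance 1 share a vertex and so differ in colour. This settles the three matchings; for
   colour 3 there remain the distances 2 and 3. *)
have n2 : 1 < n.
  case: wk => -[|d1 [|d2 p]] [+ dl <-] //=.
    by move: ndd'; rewrite -dl /= eqxx.
  move: dl => /= -> /andP[/andP[_ /set0Pn[x /setIP[xd xd']]] _].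
  have [y xy Ed] := edgeP _ _ xd; have [z xz Ed'] := edgeP _ _ xd'.
  have yz : y != z.
    by apply: contraNneq ndd' => yz; apply/eqP/val_inj; rewrite Ed Ed' yz.
  by have := phiN _ _ _ xy xz yz; rewrite -!psiE // -Ed -Ed' di d'i eqxx.
case: i di d'i => -[|[|[|[|//]]]] ilt //= di d'i.
rewrite ltnNge; apply/negP=> n3.
have [p [q [r [pd rd' pq qr]]]] := line_walk_near wk n3 ndd'.
have [p' pp' Ed] := edgeP _ _ pd; have [r' rr' Ed'] := edgeP _ _ rd'.
case/negP: ndd'; apply/eqP/val_inj; rewrite Ed Ed'.
apply: (phiD p p' q r r') => //; rewrite -psiE //; first by rewrite -Ed.
by rewrite -Ed'.
Qed.
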